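(* Let $\mathcal{V}$ be any non-distributive variety of lattices (i.e. a variety of lattices containing at least one non-distributive lattice), and let $F$ be a free lattice, or a free bounded lattice, in $\mathcal{V}$ with at least $\aleph_2$ generators. Then there exists no von Neumann regular ring $R$ whose semilattice of finitely generated two-sided ideals is isomorphic to $\mathbf{C}(F)$.
   Context: For a lattice $L$, $\mathbf{C}(L)$ denotes the congruence semilattice of $L$: the join-semilattice with zero of all compact (equivalently, finitely generated) congruences of $L$, under the join of congruences. The finitely generated two-sided ideals of a ring form a join-semilattice with zero under addition of ideals. Isomorphism is isomorphism of join-semilattices with zero. The free bounded lattice on a set $X$ in $\mathcal{V}$ is the free object on $X$ in the class of bounded lattices (with constants $0,1$ in the signature) whose underlying lattice belongs to $\mathcal{V}$. *)

(* Defs.v *)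
From HB Require Import structures.
From mathcomp Require Import all_boot all_order all_algebra.
From mathcomp Require Import all_classical.

Set Implicit Arguments.
Unset Strict Implicit.
Unset Printing Implicit Defensive.

Import Order.TTheory GRing.Theory.
Local Open Scope classical_set_scope.
Local Open Scope order_scope.

Definition card_lt (S T : Type) : Prop :=
  ([set: S] #<= [set: T])%card /\ ~ ([set: T] #<= [set: S])%card.

(* T is a set of cardinality aleph_n: aleph_0 is the cardinality of nat, and  *)
(* aleph_{n+1} is the least cardinal strictly greater than aleph_n.           *)
Fixpoint is_aleph (n : nat) (T : Type) : Prop :=
  match n with
  | 0 => ([set: T] #= [set: nat])%card
  | m.+1 => exists S : Type,
      [/\ is_aleph m S, card_lt S T
        & forall U : Type, card_lt S U -> ([set: T] #<= [set: U])%card]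
  end.

Definition at_least_aleph (n : nat) (X : Type) : Prop :=
  exists2 T : Type, is_aleph n T & ([set: T] #<= [set: X])%card.

(* A variety of lattices is the class of models of a set of lattice           *)
(* identities; it is represented by such a set.                               *)
Inductive lattice_term : Type :=
| LVar of nat
| LMeet of lattice_term & lattice_term
| LJoin of lattice_term & lattice_term.

Fixpoint lattice_eval d (L : latticeType d) (v : nat -> L)
    (t : lattice_term) : L :=
  match t with
  | LVar n => v n
  | LMeet s t => lattice_eval v s `&` lattice_eval v t
  | LJoin s t => lattice_eval v s `|` lattice_eval v t
  end.

Definition lattice_variety := set (lattice_term * lattice_term).

Definition in_variety (V : lattice_variety) d (L : latticeType d) : Prop :=
  forall e, V e ->
  forall v : nat -> L, lattice_eval v e.1 = lattice_eval v e.2.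

Definition distributive_lattice d (L : latticeType d) : Prop :=
  @right_distributive L L Order.meet Order.join.

Definition nondistributive_variety (V : lattice_variety) : Prop :=
  exists d (L : latticeType d), in_variety V L /\ ~ distributive_lattice L.

Definition lattice_hom d (L : latticeType d) d' (L' : latticeType d')
    (h : L -> L') : Prop :=
  Order.meet_morphism h /\ Order.join_morphism h.

Definition bounded_lattice_hom d (L : tbLatticeType d)
    d' (L' : tbLatticeType d') (h : L -> L') : Prop :=
  [/\ lattice_hom h, h \bot = \bot & h \top = \top].

(* F, with the map i from the set X of free generators, is free on X in V.    *)
Definition free_lattice (V : lattice_variety) (X : Type)
    d (F : latticeType d) (i : X -> F) : Prop :=
  in_variety V F /\
  forall d' (L : latticeType d') (f : X -> L), in_variety V L ->
    exists! h : F -> L, lattice_hom h /\ h \o i = f.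

Definition free_bounded_lattice (V : lattice_variety) (X : Type)
    d (F : tbLatticeType d) (i : X -> F) : Prop :=
  in_variety V F /\
  forall d' (L : tbLatticeType d') (f : X -> L), in_variety V L ->
    exists! h : F -> L, bounded_lattice_hom h /\ h \o i = f.

(* The join-semilattice with zero of the finitely generated members of a      *)
(* family C of subsets of T: the members of the form [smallest C G], G finite.*)
Section FgClosed.
Context {T : Type}.

Definition fg_closed (C : set (set T)) (A : set T) : Prop :=
  exists2 G : set T, finite_set G & A = smallest C G.

Record fgclosed (C : set (set T)) := FgClosed {
  fgset : set T;
  fgsetP : `[< fg_closed C fgset >] }.

Variable C : set (set T).

HB.instance Definition _ := [isSub for @fgset C].
HB.instance Definition _ := [Choice of fgclosed C by <:].

Fact fgclosed_display : Order.disp_t. Proof. exact: Order.Disp tt tt. Qed.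

Implicit Types A B D : fgclosed C.

Definition fg_le A B : bool := `[< fgset A `<=` fgset B >].

Fact fg_le_refl : reflexive fg_le.
Proof. by move=> A; apply/asboolP. Qed.

Fact fg_le_anti : antisymmetric fg_le.
Proof.
move=> A B /andP[/asboolP AB /asboolP BA].
by apply: val_inj; apply/seteqP; split.
Qed.

Fact fg_le_trans : transitive fg_le.
Proof.
by move=> B A D /asboolP AB /asboolP BD; apply/asboolP => x /AB /BD.
Qed.

HB.instance Definition _ :=
  Order.Le_isPOrder.Build fgclosed_display (fgclosed C)
    fg_le_refl fg_le_anti fg_le_trans.

Lemma smallest_subP (G : set T) A :
  smallest C G `<=` fgset A <-> G `<=` fgset A.
Proof.
split=> [GA x Gx|GA]; first by apply: GA; apply: sub_gen_smallest.
have /asboolP[H _ eA] := fgsetP A.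
rewrite eA => x Gx M [CM HM]; apply: Gx; split=> //.
by apply: subset_trans GA _; rewrite eA; apply: smallest_sub.
Qed.

Fact fg_join_subproof A B :
  `[< fg_closed C (smallest C (fgset A `|` fgset B)) >].
Proof.
apply/asboolP.
have /asboolP[G finG eA] := fgsetP A; have /asboolP[H finH eB] := fgsetP B.
exists (G `|` H); first by rewrite finite_setU.
rewrite eA eB; apply/seteqP; split=> x Sx M [CM sM]; apply: Sx; split=> //.
  rewrite subUset; split; apply: smallest_sub => // y Gy; apply: sM.
    by left.
  by right.
move=> y [Gy|Hy]; apply: sM; [left | right]; exact: sub_gen_smallest.
Qed.

Definition fg_join A B := FgClosed (fg_join_subproof A B).

Fact fg_leUx A B D : (fg_join A B <= D) = (A <= D) && (B <= D).
Proof.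
apply/asboolP/andP => [/smallest_subP|[/asboolP AD /asboolP BD]].
  by rewrite subUset => -[? ?]; split; apply/asboolP.
by apply/smallest_subP; rewrite subUset; split.
Qed.

HB.instance Definition _ :=
  Order.POrder_isJoinSemilattice.Build fgclosed_display (fgclosed C) fg_leUx.

Fact fg_bot_subproof : `[< fg_closed C (smallest C set0) >].
Proof. by apply/asboolP; exists set0. Qed.

Definition fg_bot := FgClosed fg_bot_subproof.

Fact fg_le0x A : fg_bot <= A.
Proof. by apply/asboolP/smallest_subP. Qed.

HB.instance Definition _ :=
  Order.hasBottom.Build fgclosed_display (fgclosed C) fg_le0x.

End FgClosed.

Definition is_congruence d (L : latticeType d) (theta : set (L * L)) : Prop :=
  [/\ forall x, theta (x, x),
      forall x y, theta (x, y) -> theta (y, x),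
      forall x y z, theta (x, y) -> theta (y, z) -> theta (x, z),
      forall x x' y y', theta (x, x') -> theta (y, y') ->
        theta (x `&` y, x' `&` y')
    & forall x x' y y', theta (x, x') -> theta (y, y') ->
        theta (x `|` y, x' `|` y')].

Lemma is_congruence_smallest d (L : latticeType d) (G : set (L * L)) :
  is_congruence (smallest (@is_congruence d L) G).
Proof.
split.
- by move=> x M [[r _ _ _ _] _]; apply: r.
- by move=> x y h M [c g]; have [_ s _ _ _] := c; apply: s; apply: h.
- move=> x y z h1 h2 M [c g]; have [_ _ t _ _] := c.
  by apply: (t _ y); [apply: h1 | apply: h2].
- move=> x x' y y' h1 h2 M [c g]; have [_ _ _ m _] := c.
  by apply: m; [apply: h1 | apply: h2].
- move=> x x' y y' h1 h2 M [c g]; have [_ _ _ _ j] := c.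
  by apply: j; [apply: h1 | apply: h2].
Qed.

(* C(L), as a bJoinSemilatticeType. *)
Definition congruence_semilattice d (L : latticeType d) :=
  fgclosed (@is_congruence d L).

(* Associative rings, not necessarily unital. *)
HB.mixin Record Zmodule_isRng R of GRing.Zmodule R := {
  rng_mul : R -> R -> R;
  rng_mulA : associative rng_mul;
  rng_mulDl : left_distributive rng_mul +%R;
  rng_mulDr : right_distributive rng_mul +%R }.

#[short(type="rngType")]
HB.structure Definition Rng := { R of Zmodule_isRng R & GRing.Zmodule R }.

Definition von_neumann_regular (R : rngType) : Prop :=
  forall a : R, exists b : R, rng_mul (rng_mul a b) a = a.

Definition two_sided_ideal (R : rngType) (I : set R) : Prop :=
  [/\ I 0%R,
      forall x y, I x -> I y -> I (x - y)%R,
      forall r x, I x -> I (rng_mul r x)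
    & forall r x, I x -> I (rng_mul x r)].

Lemma two_sided_ideal_smallest (R : rngType) (G : set R) :
  two_sided_ideal (smallest (@two_sided_ideal R) G).
Proof.
split.
- by move=> M [[z _ _ _] _].
- move=> x y h1 h2 M [c g]; have [_ s _ _] := c.
  by apply: s; [apply: h1 | apply: h2].
- by move=> r x h M [c g]; have [_ _ l _] := c; apply: l; apply: h.
- by move=> r x h M [c g]; have [_ _ _ l] := c; apply: l; apply: h.
Qed.

Definition ideal_semilattice (R : rngType) := fgclosed (@two_sided_ideal R).

Lemma ideal_semilattice_joinE (R : rngType) (I J : ideal_semilattice R) :
  fgset (I `|` J) = [set (x + y)%R | x in fgset I & y in fgset J].
Proof.
have idl (K : ideal_semilattice R) : two_sided_ideal (fgset K).
  by have /asboolP[G _ ->] := fgsetP K; apply: two_sided_ideal_smallest.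
have [I0 IB Il Ir] := idl I; have [J0 JB Jl Jr] := idl J.
apply/seteqP; split=> z.
  move=> h; apply: h; split; last first.
    move=> x [Ix|Jx]; first by exists x => //; exists 0%R; rewrite ?addr0.
    by exists 0%R => //; exists x; rewrite ?add0r.
  split.
  - by exists 0%R => //; exists 0%R; rewrite ?addr0.
  - move=> _ _ [a Ia [b Jb <-]] [a' Ia' [b' Jb' <-]].
    exists (a - a')%R; first exact: IB.
    by exists (b - b')%R; [exact: JB | rewrite opprD addrACA].
  - move=> r _ [a Ia [b Jb <-]]; exists (rng_mul r a); first exact: Il.
    by exists (rng_mul r b); [exact: Jl | rewrite rng_mulDr].
  - move=> r _ [a Ia [b Jb <-]]; exists (rng_mul a r); first exact: Ir.
    by exists (rng_mul b r); [exact: Jr | rewrite rng_mulDl].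
move=> [x Ix [y Jy <-]] M [[M0 MB _ _] sM].
have /MB : M x by apply: sM; left.
rewrite -[y]opprK; apply; rewrite -[(- y)%R]sub0r.
by apply: MB => //; apply: sM; right.
Qed.

Definition bsemilattice_iso d (S : bJoinSemilatticeType d)
    d' (S' : bJoinSemilatticeType d') : Prop :=
  exists f : S -> S',
    [/\ bijective f,
        {morph f : x y / x `|` y}
      & f \bot = \bot].

(* Main.v *)
Require Import Defs.
From HB Require Import structures.
From mathcomp Require Import all_boot all_order all_algebra.
From mathcomp Require Import all_classical.
From mathcomp Require wochoice.

(**
The two semilattices are separated by Wehrung's weak uniform refinement
property: whenever [a i `|` b i = e] for all [i], there are elements [c i j]
below [a i] and below [b j] such that [c i j `|` a j `|` b i] is above [e] and
[c i k <= c i j `|` c j k].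

In a von Neumann regular ring the finitely generated ideals have this property
([regular_weak_uniform_refinement]): decomposing an idempotent [p] of [e] along
[a i + b i = e] gives elements [f i] of [a i] with [p - f i] in [b i], and
[c i j] is the least ideal modulo which [f i = f j * f i], a transitive relation
between [f i] and [f j].

The compact congruences of a free lattice [F] do not have it
([free_not_weak_uniform_refinement]). Choose ends [bot <= top] in [F], trim the
generators to elements [w i] between them, and let [A i], [B i] be the
congruences generated by [(bot, w i)] and [(w i, top)]. Their join is the
congruence generated by [(bot, top)]; the property is applied to the family
that contains each pair [(A i, B i)] and also each pair [(B i, A i)]. The
elements of the refinement are finitely generated, hence each of them involves
finitely many generators. As there are at least aleph_2 generators,
Kuratowski's free set theorem ([free_triple]) yields [i], [j], [k] such that the
refinements indexed by two of them do not involve the third.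

The variety contains a bounded lattice with an element [y] and two complements
[x], [z] of [y] such that [z <= x] fails
([nondistributive_shared_complement], [interval_in_variety]). Let [h] map [w i],
[w j], [w k] to [x], [y], [z]. A refinement that involves only [i] and [j] sees
the distributive lattice [{bot, x, y, top}], in which being below [B i] and
[B j] makes it trivial; so [h] collapses the refinement of the pairs
[(B i, A i)], [(A j, B j)], and likewise the one of [(A j, B j)], [(B k, A k)].
By the triangle inequality [h] collapses the refinement [c] of [(B i, A i)] and
[(B k, A k)]. As [c] involves only [i] and [k], it is also collapsed when [w j]
is sent to the bottom instead, and then when [w i] and [w k] are sent to the
bottom and to the top, because [z <= x] fails. This last homomorphism also
collapses [A i] and [B k], so it collapses [c `|` B k `|` A i], which contains
[(bot, top)]: a contradiction.
*)

Set Implicit Arguments.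
Unset Strict Implicit.
Unset Printing Implicit Defensive.
Import Order.TTheory GRing.Theory.
Local Open Scope classical_set_scope.
Local Open Scope order_scope.

(** * Kuratowski's free set theorem *)

Lemma card_leTP (T U : Type) :
  ([set: T] #<= [set: U])%card <-> exists f : T -> U, injective f.
Proof.
split=> [/card_leP[g]|[f injf]].
  exists (fun t => set_val (g (to_setT t))) => x y exy.
  have /(@inj _ _ _ g) : g (to_setT x) = g (to_setT y) by apply: val_inj.
  by rewrite !inE => /(_ I I) /(congr1 set_val).
elim/Ppointed: U => U in f injf *.
  by rewrite emptyE; apply/eqP; rewrite -subset0 => t; case: (no (f t)).
by apply/pcard_injP; exists f => x y _ _; apply: injf.
Qed.

Lemma countableU (T : Type) (A B : set T) :
  countable A -> countable B -> countable (A `|` B).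
Proof.
move=> Ac Bc; rewrite -bigcup2inE.
by apply: bigcup_countable => // -[|[|//]].
Qed.

Lemma exists_well_order (S : Type) : exists le : S -> S -> Prop,
  (forall x y, le x y -> le y x -> x = y) /\
  (forall A : set S, A !=set0 -> exists2 z, A z & forall x, A x -> le z x).
Proof.
have [R woR] := wochoice.well_ordering_principle {classic S}.
have minR (A : set S) : A !=set0 -> exists2 z, A z & forall x, A x -> R z x.
  move=> [x Ax]; have [|z [[zA lbz] _]] := woR (mem A).
    by exists x; rewrite inE.
  exists z; first by move: zA; rewrite inE.
  by move=> y Ay; apply: lbz; rewrite inE.
have wcR : wochoice.wo_chain R (@predT {classic S}) by move=> A _; apply: woR.
exists (fun x y => R x y); split=> // x y xy yx.
by apply: (wochoice.wo_chain_antisymmetric wcR) => //; rewrite xy yx.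
Qed.

(** Transfinite recursion: as an initial segment has a countable image, there
    is always a point of [W] that has not been used yet. *)
Lemma injection_of_countable_segments (X S : Type) (lt : X -> X -> Prop)
    (W : set S) :
  well_founded lt -> (forall x y, x <> y -> lt x y \/ lt y x) ->
  (forall x, countable [set y | lt y x]) -> ~ countable W ->
  exists f : X -> S, injective f.
Proof.
move=> wf_lt tri segc Wunc.
have unc C : countable C -> exists s, W s /\ ~ C s.
  move=> Cc; apply: contrapT => nex; apply: Wunc; apply: sub_countable Cc.
  apply: subset_card_le => s Ws.
  by apply: contrapT => nCs; apply: nex; exists s.
have [s0 _] := unc _ (@countable0 S).
have [pick pickP] : {pick : set S -> S &
    forall C, countable C -> W (pick C) /\ ~ C (pick C)}.
  apply: (@choice (set S) S (fun C s => countable C -> W s /\ ~ C s)) => C.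
  have [/unc[s]|nC] := pselect (countable C); first by exists s.
  by exists s0.
pose step x (g : forall y, lt y x -> S) : S :=
  pick ((fun y => if pselect (lt y x) is left h then g y h else s0)
         @` [set y | lt y x]).
pose f := Fix wf_lt (fun=> S) step.
have fE x : f x = pick (f @` [set y | lt y x]).
  rewrite /f Fix_eq; last first.
    move=> z g g' gg'; congr step.
    apply: functional_extensionality_dep => y.
    by apply: functional_extensionality_dep => h; apply: gg'.
  rewrite -/f /step; congr pick; apply/seteqP; split=> s [y /= yx <-];
    by exists y => //; case: pselect.
have flt x y : lt y x -> f x <> f y.
  move=> yx fxy.
  have Cc : countable (f @` [set z | lt z x]).
    exact: sub_countable (card_image_le _ _) (segc x).
  by have [_] := pickP _ Cc; rewrite -fE; apply; exists y.
by exists f => x y fxy; apply: contrapT => /tri[] /flt; apply.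
Qed.

(** A well-ordered union of countable sets over an index set with countable
    initial segments is itself well-ordered with countable initial segments:
    order the points first by the least index whose set contains them, then by
    an enumeration of that set. *)
Lemma bigcup_countable_injection (X S : Type) (le : S -> S -> Prop) (W : set S)
    (V : S -> set X) :
  (forall x y, le x y -> le y x -> x = y) ->
  (forall A : set S, A !=set0 -> exists2 z, A z & forall x, A x -> le z x) ->
  (forall w, W w -> countable [set s | le s w]) -> ~ countable W ->
  (forall w, W w -> countable (V w)) ->
  (forall x, exists2 w, W w & V w x) ->
  exists f : X -> S, injective f.
Proof.
move=> le_anti le_min segW Wunc Vc cov.
have [rk rkP] : {rk : X -> S & forall x, (W (rk x) /\ V (rk x) x) /\
    forall w, W w /\ V w x -> le (rk x) w}.
  apply: (@choice X S (fun x r => (W r /\ V r x) /\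
    forall w, W w /\ V w x -> le r w)) => x.
  have [|z] := le_min [set w | W w /\ V w x]; last by exists z.
  by have [w] := cov x; exists w.
have [idx idxP] : {idx : S -> X -> nat & forall w, W w ->
    {in V w &, injective (idx w)}}.
  apply: (@choice S (X -> nat)
    (fun w f => W w -> {in V w &, injective f})) => w.
  have [/Vc /countable_injP[f]|nW] := pselect (W w); first by exists f.
  by exists (fun=> 0%N).
have le_total x y : le x y \/ le y x.
  have [|z zxy lez] := le_min [set x; y]; first by exists x; left.
  by case: zxy lez => -> lez; [left | right]; apply: lez; [right | left].
pose lt x y := (le (rk x) (rk y) /\ rk x <> rk y) \/
  (rk x = rk y /\ (idx (rk x) x < idx (rk y) y)%N).
apply: (@injection_of_countable_segments X S lt W).
- suff wfrk : forall r x, rk x = r -> Acc lt x.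
    by move=> x; exact: (wfrk (rk x)).
  move=> r; apply: contrapT => bad.
  have [|m /= mbad mmin] := le_min [set r | ~ forall x, rk x = r -> Acc lt x].
    by exists r.
  apply: mbad => x; have [n] := ubnP (idx m x).
  elim: n x => [x|n IH x xn xm]; first by rewrite ltn0.
  constructor=> y [[yx nyx]|[yx ixy]].
    apply: contrapT => nAcc; apply: nyx; apply: le_anti => //.
    by rewrite xm; apply: mmin => h; apply: nAcc; apply: h.
  have ym : rk y = m by rewrite yx.
  by apply: IH => //; rewrite ym xm in ixy; apply: leq_trans ixy xn.
- move=> x y nxy.
  have [rxy|nrxy] := pselect (rk x = rk y); last first.
    by case: (le_total (rk x) (rk y)); [left | right]; left; split=> // /esym.
  have [[Wx Vx] _] := rkP x; have [[Wy Vy] _] := rkP y.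
  have : idx (rk x) x != idx (rk y) y.
    apply/eqP; rewrite -rxy => /(idxP _ Wx) e; apply: nxy.
    by apply: e; rewrite inE// rxy.
  by rewrite neq_ltn => /orP[]; [left | right]; right.
- move=> x; have [[Wx Vx] _] := rkP x.
  apply: (@sub_countable _ _ _
    (\bigcup_(w in [set s | le s (rk x)] `&` W) V w)).
    apply: subset_card_le => y yx; have [[Wy Vy] _] := rkP y.
    exists (rk y); last exact: Vy.
    split; last exact: Wy.
    case: yx => [[]//|[-> _]].
    by case: (le_total (rk x) (rk x)).
  apply: bigcup_countable; last by move=> w [_ /Vc].
  by apply: sub_countable (segW _ Wx); apply: subset_card_le => ? [].
- exact: Wunc.
Qed.

(** Kuratowski's free set theorem for pairs. [W] plays the role of the ordinal
    omega_1, embedded in [X] by [a]. The sets [Phi i j] with [i], [j] in the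
    image of [W] cannot cover [X], which is too large; this provides [k].
    Inside [W], the countable set [B] and the countably many points met by the
    sets [Phi i k], for [i] in [B], leave out some [j]; finally [Phi j k] is
    finite and [B] is infinite, so that it misses some [i] in [B]. *)
Lemma free_triple (X : Type) (hX : at_least_aleph 2 X) (Phi : X -> X -> set X) :
  (forall i j, finite_set (Phi i j)) ->
  exists i j k, [/\ ~ Phi j k i, ~ Phi i k j & ~ Phi i j k].
Proof.
move=> finPhi; case: hX => T [S [[N [Nnat [_ SN] _]] [ST TS] _]].
move/card_leTP: ST => [st st_inj].
move=> /card_leTP[tx tx_inj].
pose a s := tx (st s); have a_inj : injective a by move=> x y /tx_inj /st_inj.
have Sunc : ~ countable [set: S].
  by move=> Sc; apply: SN; apply: card_le_trans Sc _; case/card_eqPle: Nnat.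
have [le [le_anti le_min]] := exists_well_order S.
have le_refl s : le s s.
  by have [|z -> lez] := le_min [set s]; [exists s | apply: lez].
pose W := [set w | countable [set s | le s w /\ s <> w]].
(* The points with countable initial segment form an initial segment, which is
   uncountable: otherwise its least strict upper bound would belong to it. *)
have segW w : W w -> countable [set s | le s w].
  move=> Ww; apply: (@sub_countable _ _ _
    ([set s | le s w /\ s <> w] `|` [set w])).
    apply: subset_card_le => s /= sw.
    by have [->|] := pselect (s = w); [right | left].
  by apply: countableU => //; exact: countable1.
have Wunc : ~ countable W.
  move=> Wc; have [WT|] := pselect (W = setT); first by rewrite WT in Wc.
  move=> WT; have [|m mW mmin] := le_min (~` W).
    apply: contrapT => nW; apply: WT; apply/seteqP; split=> // s _.
    by apply: contrapT => nWs; apply: nW; exists s.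
  apply: mW; apply: sub_countable Wc; apply: subset_card_le => s [sm nsm].
  by apply: contrapT => nWs; apply: nsm; apply: le_anti => //; apply: mmin.
have [k kfree] : exists k, forall v w, W v -> W w -> ~ Phi (a v) (a w) k.
  apply: contrapT => nk; apply: TS.
  pose V w := \bigcup_(v in [set s | le s w])
    \bigcup_(v' in [set s | le s w]) Phi (a v) (a v').
  have [] // := @bigcup_countable_injection X S le W V.
  - move=> w Ww; apply: bigcup_countable => [|v _]; first exact: segW.
    apply: bigcup_countable => [|v' _]; first exact: segW.
    exact: finite_set_countable.
  - move=> x; apply: contrapT => nx; apply: nk; exists x => v w Wv Ww Pvw.
    have [|m mvw mmin] := le_min [set s | (s = v \/ s = w) /\ le v s /\ le w s].
      have [|z zxy lez] := le_min [set v; w]; first by exists v; left.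
      by case: zxy lez => -> lez; [exists w | exists v]; split; auto;
        split=> //; apply: lez; [right | left].
    case: mvw => mvw [vm wm]; apply: nx; exists m; first by case: mvw => ->.
    by exists v => //; exists w.
  - move=> f f_inj; apply/card_leTP; exists (f \o tx).
    by move=> x y /f_inj /tx_inj.
have [B BW [Binf Bc]] : exists2 B, B `<=` W & infinite_set B /\ countable B.
  have : infinite_set W by move=> /finite_set_countable.
  move/infiniteP; have [s0 _] : W !=set0.
    by apply/set0P/eqP => W0; apply: Wunc; rewrite W0.
  pose SP : pointedType := HB.pack S (gen_eqMixin S) (gen_choiceMixin S)
    (isPointed.Build S s0).
  move=> /(@pcard_leP _ SP)[b].
  exists (range b); first by move=> _ [n _ <-]; apply: (@funS _ _ setT).
  split; last exact: sub_countable (card_image_le _ _) _.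
  move=> finB; apply: infinite_nat.
  apply: (@sub_finite_set _ _ (b @^-1` range b)); first by move=> n _; exists n.
  by apply: finite_preimage finB => m n _ _; apply: inj; rewrite inE.
pose bad := B `|` \bigcup_(b in B) (a @^-1` Phi (a b) k).
have badc : countable bad.
  apply: countableU => //.
  apply: bigcup_countable => // b _.
  apply: finite_set_countable; apply: finite_preimage => //.
  by move=> x y _ _; apply: a_inj.
have [j Wj jbad] : exists2 j, W j & ~ bad j.
  apply: contrapT => nj; apply: Wunc; apply: sub_countable badc.
  by apply: subset_card_le => s Ws; apply: contrapT => ns; apply: nj; exists s.
have [i Bi iP] : exists2 i, B i & ~ Phi (a j) k (a i).
  apply: contrapT => ni; apply: Binf.
  apply: (@sub_finite_set _ _ (a @^-1` Phi (a j) k)).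
    by move=> s Bs; apply: contrapT => ns; apply: ni; exists s.
  by apply: finite_preimage => // x y _ _; apply: a_inj.
exists (a i), (a j), k; split=> //.
  by move=> Pj; apply: jbad; right; exists i.
by apply: kfree => //; apply: BW.
Qed.

(** * The weak uniform refinement property in regular rings *)

(** Wehrung's property, required at every element [e] of [S]. *)
Definition weak_uniform_refinement d (S : bJoinSemilatticeType d) : Prop :=
  forall (I : Type) (a b : I -> S) (e : S), (forall i, a i `|` b i = e) ->
  exists c : I -> I -> S,
    [/\ forall i j, c i j <= a i,
        forall i j, c i j <= b j,
        forall i j, e <= c i j `|` a j `|` b i
      & forall i j k, c i k <= c i j `|` c j k].

Lemma weak_uniform_refinement_iso d (S : bJoinSemilatticeType d)
    d' (S' : bJoinSemilatticeType d') :
  bsemilattice_iso S S' -> weak_uniform_refinement S ->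
  weak_uniform_refinement S'.
Proof.
move=> [f [[g fK gK] fU _]] wurS I a b e abe.
have gU : {morph g : x y / x `|` y}.
  by move=> x y; apply: (can_inj fK); rewrite fU !gK.
have g_le x y : (g x <= g y) = (x <= y).
  by rewrite !leEjoin -gU (can_eq gK).
have [|c [ca cb abc tri]] := wurS I (g \o a) (g \o b) (g e).
  by move=> i /=; rewrite -gU abe.
exists (fun i j => f (c i j)); split=> [i j|i j|i j|i j k];
  by rewrite -g_le ?gU ?fK.
Qed.

Lemma fg_leP (T : Type) (C : set (set T)) (A B : fgclosed C) :
  reflect (fgset A `<=` fgset B) (A <= B).
Proof. exact: asboolP. Qed.

Definition fg_span (T : Type) (C : set (set T)) (G : set T)
    (finG : finite_set G) : fgclosed C :=
  FgClosed (asboolT (ex_intro2 (finite_set (T:=T)) _ G finG erefl) :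
    `[< fg_closed C (smallest C G) >]).

Lemma fg_joinU_sub (T : Type) (C : set (set T)) (A B : fgclosed C) (M : set T) :
  C M -> fgset A `<=` M -> fgset B `<=` M -> fgset (A `|` B) `<=` M.
Proof. by move=> CM AM BM; apply: smallest_sub; rewrite // subUset. Qed.

Section RegularRing.
Local Open Scope ring_scope.
Context {R : rngType}.
Implicit Types (x y z : R) (I : ideal_semilattice R).
Local Notation "x ** y" := (rng_mul x y) (at level 40, left associativity).

Lemma rng_mulBr x y z : x ** (y - z) = x ** y - x ** z.
Proof. by apply/(addIr (x ** z)); rewrite -rng_mulDr !subrK. Qed.

Lemma rng_mulBl x y z : (x - y) ** z = x ** z - y ** z.
Proof. by apply/(addIr (y ** z)); rewrite -rng_mulDl !subrK. Qed.

Lemma fgset_ideal I : two_sided_ideal (fgset I).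
Proof.
by have /asboolP[G _ ->] := fgsetP I; apply: two_sided_ideal_smallest.
Qed.

Lemma ideal_add (M : set R) x y : two_sided_ideal M -> M x -> M y -> M (x + y).
Proof.
move=> [M0 MB _ _] Mx My; rewrite -[y]opprK; apply: (MB) => //.
by rewrite -sub0r; apply: MB.
Qed.

Lemma regular_left_unit (reg : von_neumann_regular R) x :
  exists p, [/\ p ** p = p, p ** x = x & exists b, p = x ** b].
Proof.
have [b xbx] := reg x; exists (x ** b); split=> //; last by exists b.
by rewrite rng_mulA xbx.
Qed.

(** The ideal [e] is generated by finitely many idempotents [p g]. Splitting
    [p g = x + y] with [x] in [a i] and [y] in [b i], the element
    [f i g = p g * x] is zero modulo [a i] and equal to [p g] modulo [b i].
    The ideal [c i j] is the least one that forces [f i g = f j g * f i g]. As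
    [f i = f j * f i] and [f j = f k * f j] imply [f i = f k * f i], this gives
    the triangle inequality; the other properties come from putting [p g] or
    zero for [f i g] and [f j g]. *)
Lemma regular_weak_uniform_refinement :
  von_neumann_regular R -> weak_uniform_refinement (ideal_semilattice R).
Proof.
move=> reg I a b e abe.
have /asboolP[G finG eG] := fgsetP e.
have [p pP] := boolp.choice (regular_left_unit reg).
have pe g : G g -> fgset e (p g).
  move=> Gg; have [_ _ [r ->]] := pP g; have [_ _ _ er] := fgset_ideal e.
  by apply: er; rewrite eG; apply: sub_gen_smallest.
have [f fP] : {f : I -> R -> R & forall i g, G g ->
    [/\ fgset (a i) (f i g), fgset (b i) (p g - f i g)
      & p g ** f i g = f i g]}.
  apply: (@boolp.choice I (R -> R) (fun i f => forall g, G g ->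
    [/\ fgset (a i) (f g), fgset (b i) (p g - f g) & p g ** f g = f g])) => i.
  suff /boolp.choice[h hP] : forall g, exists y, G g ->
      [/\ fgset (a i) y, fgset (b i) (p g - y) & p g ** y = y].
    by exists h.
  move=> g; have [Gg|nGg] := pselect (G g); last by exists 0.
  have [pp _ _] := pP g.
  have := pe g Gg; rewrite -(abe i) ideal_semilattice_joinE.
  move=> [x ax [y ay pxy]].
  have [_ _ al _] := fgset_ideal (a i); have [_ _ bl _] := fgset_ideal (b i).
  exists (p g ** x); split; [exact: al | | by rewrite rng_mulA pp].
  have -> : p g - p g ** x = p g ** y.
    by rewrite -[X in X - _]pp -{2}pxy rng_mulDr addrC addKr.
  exact: bl.
pose D i j g := f i g - f j g ** f i g.
have finD i j : finite_set (D i j @` G) by apply: finite_image.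
have DE i j g : G g -> D i j g = (p g - f j g) ** f i g.
  by move=> /(fP i)[_ _ pf]; rewrite rng_mulBl pf.
pose c i j : ideal_semilattice R := fg_span _ (finD i j).
have sub_c i j (A : ideal_semilattice R) :
    (forall g, G g -> fgset A (D i j g)) -> (c i j <= A)%O.
  move=> DA; apply/fg_leP; apply: smallest_sub; first exact: fgset_ideal.
  by move=> _ [g Gg <-]; apply: DA.
have c_gen i j g : G g -> fgset (c i j) (D i j g).
  by move=> Gg; apply: (@sub_gen_smallest _ _ (D i j @` G)); exists g.
exists c; split.
- move=> i j; apply: sub_c => g Gg; rewrite DE//.
  have [ag _ _] := fP i g Gg; have [_ _ al _] := fgset_ideal (a i).
  exact: al.
- move=> i j; apply: sub_c => g Gg; rewrite DE//.
  have [_ bg _] := fP j g Gg; have [_ _ _ br] := fgset_ideal (b j).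
  exact: br.
- move=> i j; set J := Order.join _ _; have idJ := fgset_ideal J.
  have [_ _ Jl Jr] := idJ.
  have /fg_leP cJ : (c i j <= J)%O by rewrite lexU2// lexU2// lexx.
  have /fg_leP aJ : (a j <= J)%O by rewrite lexU2// lexU2// lexx orbT.
  have /fg_leP bJ : (b i <= J)%O by rewrite lexU2// lexx orbT.
  apply/fg_leP; rewrite eG; apply: smallest_sub => // g Gg.
  have [_ {3}<- _] := pP g; apply: (Jr).
  have [_ bi _] := fP i g Gg; have [aj _ _] := fP j g Gg.
  rewrite -[p g](subrK (f i g)); apply: (@ideal_add (fgset J)) => //.
    exact: bJ.
  rewrite -[f i g](subrK (f j g ** f i g)); apply: (@ideal_add (fgset J)) => //.
    by apply: cJ; apply: c_gen.
  by apply: Jr; apply: aJ.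
- move=> i j k; apply: sub_c => g Gg.
  set J := Order.join _ _; have idJ := fgset_ideal J; have [_ JB Jl Jr] := idJ.
  have /fg_leP c1 : (c i j <= J)%O by rewrite lexU2// lexx.
  have /fg_leP c2 : (c j k <= J)%O by rewrite lexU2// lexx orbT.
  have J1 : fgset J (D i j g) by apply: c1; apply: c_gen.
  have J2 : fgset J (D j k g) by apply: c2; apply: c_gen.
  have -> : D i k g = D i j g - f k g ** D i j g + D j k g ** f i g.
    rewrite /D rng_mulBr rng_mulBl rng_mulA.
    by rewrite opprB -addrA [X in _ = _ + X]addrC !subrKA.
  by apply: (@ideal_add (fgset J)); [|apply: JB => //; apply: Jl|apply: Jr].
Qed.

End RegularRing.

(** * Relative complements in nondistributive lattices *)

Lemma join_le d (L : latticeType d) (x y z : L) :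
  x <= z -> y <= z -> x `|` y <= z.
Proof. by move=> xz yz; rewrite leUx xz. Qed.

Lemma le_meet d (L : latticeType d) (x y z : L) :
  z <= x -> z <= y -> z <= x `&` y.
Proof. by move=> zx zy; rewrite lexI zx. Qed.

(* Whitman-style proof search for inequalities between lattice terms. *)
Ltac lat := solve [exact: lexx | assumption
  | apply: join_le; lat | apply: le_meet; lat
  | apply: lexUl; lat | apply: lexUr; lat
  | apply: leIxl; lat | apply: leIxr; lat].

Definition modular_law d (L : latticeType d) : Prop :=
  forall x y z : L, x <= z -> x `|` (y `&` z) = (x `|` y) `&` z.

Definition shared_complement d (L : latticeType d) (o e x y z : L) : Prop :=
  [/\ x `&` y = o, x `|` y = e, z `&` y = o & z `|` y = e].

(** The configuration is a pentagon generated by a failure of modularity. *)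
Lemma nonmodular_shared_complement d (L : latticeType d) :
  ~ modular_law L -> exists o e x y z : L,
    shared_complement o e x y z /\ ~~ (z <= x).
Proof.
move=> nmod; have [x [y [z [xz neq]]]] : exists x y z : L, x <= z /\
    x `|` (y `&` z) != (x `|` y) `&` z.
  apply: contrapT => nex; apply: nmod => x y z xz; apply/eqP.
  by apply: contrapT => /negP neq; apply: nex; exists x, y, z.
have le : x `|` (y `&` z) <= (x `|` y) `&` z by lat.
exists (y `&` z), (x `|` y), (x `|` (y `&` z)), y, ((x `|` y) `&` z).
have q_meet : ((x `|` y) `&` z) `&` y = y `&` z by rewrite meetAC joinIK.
have p_join : (x `|` (y `&` z)) `|` y = x `|` y by rewrite joinAC -joinA meetKU.
split; first split=> //.
- apply/le_anti/andP; split; last by lat.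
  by rewrite -[leRHS]q_meet leI2.
- apply/le_anti/andP; split; first by lat.
  by rewrite -[leLHS]p_join leU2.
- by apply: contra neq => le'; apply/eqP/le_anti; rewrite le.
Qed.

(** Birkhoff's construction of a diamond in a modular, nondistributive lattice:
    the three elements [to_medians] are pairwise complements of each other
    between the two medians. *)
Section Median.
Context {d : Order.disp_t} {L : latticeType d}.
Implicit Types a b c : L.

Definition lower_median a b c := (a `&` b) `|` (b `&` c) `|` (c `&` a).
Definition upper_median a b c := (a `|` b) `&` (b `|` c) `&` (c `|` a).
Definition to_medians a b c :=
  lower_median a b c `|` (a `&` upper_median a b c).

Lemma lower_medianC a b c : lower_median a b c = lower_median b c a.
Proof. by rewrite /lower_median -joinA joinC. Qed.

Lemma upper_medianC a b c : upper_median a b c = upper_median b c a.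
Proof. by rewrite /upper_median -meetA meetC. Qed.

Lemma lower_le_upper a b c : lower_median a b c <= upper_median a b c.
Proof. rewrite /lower_median /upper_median; lat. Qed.

Lemma meet_to_medians a b c : modular_law L ->
  to_medians a b c `&` to_medians b c a = lower_median a b c.
Proof.
move=> mod; rewrite /to_medians -(upper_medianC a) -(lower_medianC a).
have lu := lower_le_upper a b c.
set l := lower_median a b c in lu *; set u := upper_median a b c in lu *.
rewrite meetC -mod; last lat.
apply/join_idPl.
have w_b : (b `&` u) `&` (l `|` (a `&` u)) <= b by lat.
have w_abc : (b `&` u) `&` (l `|` (a `&` u)) <= (b `&` c) `|` a.
  by rewrite /l /lower_median; lat.
apply: (@le_trans _ _ (((b `&` c) `|` a) `&` b)); first lat.
by rewrite -mod; [rewrite /l /lower_median|]; lat.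
Qed.

End Median.

Lemma dual_modular_law d (L : latticeType d) :
  modular_law L -> modular_law (L^d).
Proof.
move=> mod; suff e (x y z : L) : z <= x -> x `&` (y `|` z) = (x `&` y) `|` z.
  by move=> x y z; apply: e.
by move=> zx; rewrite meetC [y `|` z]joinC -mod// joinC [y `&` x]meetC.
Qed.

Lemma join_to_medians d (L : latticeType d) (a b c : L) : modular_law L ->
  to_medians a b c `|` to_medians b c a = upper_median a b c.
Proof.
move=> mod.
have dual (x y z : L) :
    to_medians x y z = upper_median x y z `&` (x `|` lower_median x y z).
  by rewrite /to_medians mod ?lower_le_upper// meetC joinC.
rewrite !dual.
exact: (@meet_to_medians _ (L^d) a b c (dual_modular_law mod)).
Qed.

(** A replacement for the embedding of the pentagon or of the diamond: all that
    is used of either lattice is that relative complements are not unique. *)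
Lemma nondistributive_shared_complement d (L : latticeType d) :
  ~ distributive_lattice L -> exists o e x y z : L,
    shared_complement o e x y z /\ ~~ (z <= x).
Proof.
move=> ndis; have [mod|] := pselect (modular_law L); last first.
  exact: nonmodular_shared_complement.
have [a [b [c neq]]] : exists a b c : L,
    a `&` (b `|` c) != (a `&` b) `|` (a `&` c).
  apply: contrapT => nex; apply: ndis => a b c; apply/eqP.
  by apply: contrapT => /negP neq; apply: nex; exists a, b, c.
pose l := lower_median a b c; pose u := upper_median a b c.
pose x := to_medians a b c; pose y := to_medians b c a.
pose z := to_medians c a b.
have lu : l != u.
  apply: contra neq => /eqP e; apply/eqP.
  have au : a `&` u = a `&` (b `|` c).
    by apply/le_anti/andP; rewrite /u /upper_median; split; lat.
  have al : a `&` l = (a `&` b) `|` (a `&` c).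
    have -> : l = ((a `&` b) `|` (a `&` c)) `|` (b `&` c).
      by rewrite /l /lower_median joinAC [c `&` a]meetC.
    rewrite meetC -mod; last lat.
    by apply/join_idPl; lat.
  by rewrite -au -e.
have xy_l : x `&` y = l by apply: meet_to_medians.
have xy_u : x `|` y = u by apply: join_to_medians.
have yz_l : y `&` z = l by rewrite meet_to_medians// -(lower_medianC a).
have yz_u : y `|` z = u by rewrite join_to_medians// -(upper_medianC a).
have zx_l : z `&` x = l by rewrite meet_to_medians// (lower_medianC c).
have zx_u : z `|` x = u by rewrite join_to_medians// (upper_medianC c).
have [zx|zx] := boolP (z <= x).
  exists l, u, z, y, x; split; first by split; rewrite // (meetC, joinC).
  apply: contra lu => xz.
  by rewrite -zx_l -zx_u (meet_idPl zx) (join_idPr zx); apply/eqP/le_anti/andP.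
by exists l, u, x, y, z; split=> //; split; rewrite // (meetC, joinC).
Qed.

(** * Sublattices and varieties *)

Lemma lattice_eval_hom d (L : latticeType d) d' (L' : latticeType d')
    (h : L -> L') (v : nat -> L) t :
  lattice_hom h -> h (lattice_eval v t) = lattice_eval (h \o v) t.
Proof.
by move=> [hI hU]; elim: t => //= [s IHs t IHt|s IHs t IHt];
  rewrite (hI, hU) IHs IHt.
Qed.

Lemma in_variety_inj V d (L : latticeType d) d' (L' : latticeType d')
    (h : L -> L') :
  lattice_hom h -> injective h -> in_variety V L' -> in_variety V L.
Proof.
move=> hh hinj VL e Ve v; apply: hinj.
by rewrite !lattice_eval_hom//; apply: VL.
Qed.

Section Sublattice.
Context {d : Order.disp_t} {L : latticeType d} (P : latticeClosed L).

Definition sublattice := {x : L | x \in P}.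
HB.instance Definition _ := SubChoice.on sublattice.
HB.instance Definition _ := [SubChoice_isSubLattice of sublattice by <: with d].

Lemma val_sublattice_hom : lattice_hom (val : sublattice -> L).
Proof. by split=> x y; rewrite ?omorphI ?omorphU. Qed.

End Sublattice.

Lemma interval_in_variety V d (L : latticeType d) (o e x y z : L) :
  in_variety V L -> shared_complement o e x y z ->
  exists d' (M : tbLatticeType d') (x' y' z' : M), in_variety V M /\
    shared_complement \bot \top x' y' z' /\ (z' <= x') = (z <= x).
Proof.
move=> VL [xyo xye zyo zye].
have oe : o <= e by rewrite -xyo -xye; lat.
pose Q : {pred L} := [pred t : L | o <= t <= e].
have cI : meet_closed Q.
  move=> s t /andP[os se] /andP[ot te].
  by rewrite inE /= lexI os ot (le_trans _ se) ?leIl.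
have cU : join_closed Q.
  move=> s t /andP[os se] /andP[ot te].
  by rewrite inE /= leUx se te (le_trans os) ?leUl.
pose P : latticeClosed L := HB.pack Q
   (Order.isLatticeClosed.Build d L Q cI cU).
have oP : o \in P by rewrite inE /= lexx oe.
have eP : e \in P by rewrite inE /= lexx oe.
pose oS : sublattice P := exist _ o oP; pose eS : sublattice P := exist _ e eP.
have o_le (t : sublattice P) : oS <= t.
  by rewrite -Order.le_val; case/andP: (valP t).
have le_e (t : sublattice P) : t <= eS.
  by rewrite -Order.le_val; case/andP: (valP t).
pose M : tbLatticeType d := HB.pack (sublattice P)
  (Order.hasBottom.Build d (sublattice P) o_le)
  (Order.hasTop.Build d (sublattice P) le_e).
have xP : x \in P by rewrite inE /= -xyo -xye leUl leIl.
have yP : y \in P by rewrite inE /= -xyo -xye leUr leIr.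
have zP : z \in P by rewrite inE /= -zyo -zye leUl leIl.
exists d, M, (exist _ x xP), (exist _ y yP), (exist _ z zP); split; last split.
- exact: (in_variety_inj (@val_sublattice_hom _ _ P) val_inj).
- have [hI hU] := @val_sublattice_hom _ _ P.
  by split; apply: val_inj; [exact: etrans (hI _ _) _|exact: etrans (hU _ _) _
    |exact: etrans (hI _ _) _|exact: etrans (hU _ _) _].
- by rewrite -Order.le_val.
Qed.

(** * Free lattices *)

Definition generated_by d (F : latticeType d) (A : set F) : Prop :=
  forall P : set F, A `<=` P ->
    (forall p q, P p -> P q -> P (p `&` q)) ->
    (forall p q, P p -> P q -> P (p `|` q)) -> forall p, P p.

Definition ends_hom d (F : latticeType d) (o e : F) d' (L : tbLatticeType d')
    (h : F -> L) : Prop :=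
  [/\ lattice_hom h, h o = \bot & h e = \top].

(** Common ground between the two kinds of free lattices. In the bounded case
    [o] and [e] are the bounds; in the unbounded one two generators, of indices
    [u] and [v], stand for them. Sending these generators to the bounds of the
    target makes the required extensions exist in both cases. *)
Definition free_over_ends (V : lattice_variety) (X : Type) d (F : latticeType d)
    (gen : X -> F) (o e : F) (u v : X) : Prop :=
  generated_by (range gen `|` [set o; e]) /\
  forall d' (L : tbLatticeType d') (f : X -> L), in_variety V L ->
    f u = \bot -> f v = \top ->
    exists2 h : F -> L, ends_hom o e h & forall i, h (gen i) = f i.

Lemma sublattice_exists d (L : latticeType d) (P : set L) :
  (forall p q, P p -> P q -> P (p `&` q)) ->
  (forall p q, P p -> P q -> P (p `|` q)) ->
  exists Q : latticeClosed L, forall x, (x \in Q) <-> P x.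
Proof.
move=> PI PU; pose Q : {pred L} := [pred x | `[< P x >]].
have cI : meet_closed Q by move=> s t /asboolP Ps /asboolP Pt; apply/asboolP/PI.
have cU : join_closed Q by move=> s t /asboolP Ps /asboolP Pt; apply/asboolP/PU.
exists (HB.pack Q (Order.isLatticeClosed.Build d L Q cI cU) : latticeClosed L).
by move=> x; split=> /asboolP.
Qed.

Lemma lattice_hom_comp d1 (L1 : latticeType d1) d2 (L2 : latticeType d2)
    d3 (L3 : latticeType d3) (g : L2 -> L3) (h : L1 -> L2) :
  lattice_hom g -> lattice_hom h -> lattice_hom (g \o h).
Proof.
by move=> [gI gU] [hI hU]; split=> x y /=; rewrite (hI, hU) (gI, gU).
Qed.

(** The homomorphism to the sublattice cut out by [P], followed by the
    inclusion, must be the identity. *)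
Lemma free_lattice_generated V X d (F : latticeType d) (gen : X -> F) :
  free_lattice V gen -> generated_by (range gen).
Proof.
move=> [VF freeF] P genP PI PU p.
have [Q QP] := sublattice_exists PI PU.
have genQ i : gen i \in Q by apply/QP/genP; exists i.
have VQ : in_variety V (sublattice Q).
  exact: (in_variety_inj (@val_sublattice_hom _ _ Q) val_inj).
have [h [[hh hgen] _]] :=
  freeF _ (sublattice Q) (fun i => exist _ (gen i) (genQ i)) VQ.
have [id' [_ uniq]] := freeF _ F gen VF.
have e1 : id' = val \o h.
  apply: uniq; split.
    exact: lattice_hom_comp (@val_sublattice_hom _ _ Q) hh.
  by rewrite -compA hgen.
have e2 : id' = id by apply: uniq.
by apply/QP; rewrite -[p]/(id p) -e2 e1; apply: valP.
Qed.

Lemma free_bounded_lattice_generated V X d (F : tbLatticeType d)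
    (gen : X -> F) :
  free_bounded_lattice V gen -> generated_by (range gen `|` [set \bot; \top]).
Proof.
move=> [VF freeF] P genP PI PU p.
have [Q QP] := sublattice_exists PI PU.
have genQ i : gen i \in Q by apply/QP/genP; left; exists i.
have botQ : \bot \in Q by apply/QP/genP; right; left.
have topQ : \top \in Q by apply/QP/genP; right; right.
pose bQ : sublattice Q := exist _ \bot botQ.
pose tQ : sublattice Q := exist _ \top topQ.
have bQ_le (t : sublattice Q) : bQ <= t by rewrite -Order.le_val le0x.
have le_tQ (t : sublattice Q) : t <= tQ by rewrite -Order.le_val lex1.
pose M : tbLatticeType d := HB.pack (sublattice Q)
  (Order.hasBottom.Build d (sublattice Q) bQ_le)
  (Order.hasTop.Build d (sublattice Q) le_tQ).
have VM : in_variety V M.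
  exact: (in_variety_inj (@val_sublattice_hom _ _ Q) val_inj).
have [h [[[hh h0 h1] hgen] _]] :=
  freeF _ M (fun i => exist _ (gen i) (genQ i)) VM.
have [id' [_ uniq]] := freeF _ F gen VF.
have e1 : id' = val \o h.
  apply: uniq; split; last by rewrite -compA hgen.
  split; first exact: lattice_hom_comp (@val_sublattice_hom _ _ Q) hh.
    by rewrite /= h0.
  by rewrite /= h1.
have e2 : id' = id by apply: uniq.
by apply/QP; rewrite -[p]/(id p) -e2 e1; apply: valP.
Qed.

Lemma free_lattice_over_ends V X d (F : latticeType d) (gen : X -> F) u v :
  free_lattice V gen -> free_over_ends V gen (gen u) (gen v) u v.
Proof.
move=> freeF; split.
  move=> P genP; apply: (free_lattice_generated freeF).
  by move=> p genp; apply: genP; left.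
move=> d' L f VL fu fv; have [_ /(_ _ L f VL)[h [[hh hf] _]]] := freeF.
by exists h => [|i]; [split|]; rewrite // -?fu -?fv -hf.
Qed.

Lemma free_bounded_lattice_over_ends V X d (F : tbLatticeType d) (gen : X -> F)
    u v :
  free_bounded_lattice V gen -> free_over_ends V gen \bot \top u v.
Proof.
move=> freeF; split; first exact: (free_bounded_lattice_generated freeF).
move=> d' L f VL fu fv; have [_ /(_ _ L f VL)[h [[hh hf] _]]] := freeF.
by exists h => [|i]; rewrite // -hf.
Qed.

(** * Congruences *)

Lemma ker_congruence d (F : latticeType d) d' (L : latticeType d')
    (h : F -> L) :
  lattice_hom h -> is_congruence [set pq | h pq.1 = h pq.2].
Proof.
move=> [hI hU]; split=> //= [x y z -> //|x x' y y'|x x' y y'].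
- by rewrite !hI => -> ->.
- by rewrite !hU => -> ->.
Qed.

Definition principal_congruence d (F : latticeType d) (p q : F) :
    congruence_semilattice F :=
  fg_span (@is_congruence d F) (finite_set1 (p, q)).

Lemma principal_congruence_mem d (F : latticeType d) (p q : F) :
  fgset (principal_congruence p q) (p, q).
Proof. exact: (@sub_gen_smallest _ _ [set (p, q)]). Qed.

Arguments principal_congruence_mem {d F} p q.

Lemma principal_congruence_sub d (F : latticeType d) (p q : F)
    (M : set (F * F)) :
  is_congruence M -> M (p, q) -> fgset (principal_congruence p q) `<=` M.
Proof. by move=> CM Mpq; apply: smallest_sub => // _ ->. Qed.

Lemma fgset_congruence d (F : latticeType d) (c : congruence_semilattice F) :
  is_congruence (fgset c).
Proof. by have /asboolP[G _ ->] := fgsetP c; apply: is_congruence_smallest. Qed.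

Lemma principal_congruence_split d (F : latticeType d) (p q r : F) :
  p <= q -> q <= r ->
  principal_congruence p q `|` principal_congruence q r =
  principal_congruence p r.
Proof.
move=> pq qr; apply/le_anti; rewrite leUx; apply/andP; split; last first.
  have [_ _ ctrans _ _] :=
    fgset_congruence (principal_congruence p q `|` principal_congruence q r).
  apply/fg_leP; apply: principal_congruence_sub; first exact: fgset_congruence.
  by apply: (ctrans _ q); apply: (sub_gen_smallest (C := @is_congruence d F));
    [left | right]; apply: principal_congruence_mem.
have [crefl csym _ cI cU] := fgset_congruence (principal_congruence p r).
have pr := principal_congruence_mem p r.
apply/andP; split; apply/fg_leP; apply: principal_congruence_sub;
  try exact: fgset_congruence.
- by have := cI _ _ _ _ pr (crefl q); rewrite (meet_idPl pq) (meet_idPr qr).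
- by have := cU _ _ _ _ pr (crefl q); rewrite (join_idPr pq) (join_idPl qr).
Qed.

(** * Kernels of homomorphisms that preserve the ends *)
Section Homs.
Context {X : Type} {d : Order.disp_t} {F : latticeType d} {gen : X -> F}.
Context {o e : F} {d' : Order.disp_t} {L : tbLatticeType d'}.
Hypothesis genF : generated_by (range gen `|` [set o; e]).
Implicit Types (h : F -> L) (x y z : L) (p q : F).

Lemma ends_hom_ind (P : set F) : P o -> P e -> (forall i, P (gen i)) ->
  (forall p q, P p -> P q -> P (p `&` q)) ->
  (forall p q, P p -> P q -> P (p `|` q)) -> forall p, P p.
Proof.
by move=> Po Pe Pgen; apply: genF => _ [[i _ <-]|[->|->]].
Qed.

Lemma finite_support p : exists T : set X, finite_set T /\
  forall h h', ends_hom o e h -> ends_hom o e h' ->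
    (forall i, T i -> h (gen i) = h' (gen i)) -> h p = h' p.
Proof.
move: p; apply: ends_hom_ind =>
  [||i|p q [S [finS SP]] [T [finT TP]]|p q [S [finS SP]] [T [finT TP]]].
- by exists set0; split=> // h h' [_ -> _] [_ -> _].
- by exists set0; split=> // h h' [_ _ ->] [_ _ ->].
- by exists [set i]; split; [exact: finite_set1 | move=> h h' _ _; apply].
- exists (S `|` T); split; first by rewrite finite_setU.
  move=> h h' hh hh' hST; have [[hI _] _ _] := hh; have [[hI' _] _ _] := hh'.
  by rewrite hI hI' (SP h h')// => [|i Si]; [rewrite (TP h h')// => i Ti|];
    apply: hST; [right|left].
- exists (S `|` T); split; first by rewrite finite_setU.
  move=> h h' hh hh' hST; have [[_ hU] _ _] := hh; have [[_ hU'] _ _] := hh'.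
  by rewrite hU hU' (SP h h')// => [|i Si]; [rewrite (TP h h')// => i Ti|];
    apply: hST; [right|left].
Qed.

(** Only the finitely many pairs that generate [c] have to be looked at. *)
Lemma congruence_support (c : congruence_semilattice F) : exists T : set X,
  finite_set T /\ forall h h', ends_hom o e h -> ends_hom o e h' ->
    (forall i, T i -> h (gen i) = h' (gen i)) ->
    fgset c `<=` [set pq | h pq.1 = h pq.2] ->
    fgset c `<=` [set pq | h' pq.1 = h' pq.2].
Proof.
have [supp suppP] := boolp.choice finite_support.
have /asboolP[G finG cG] := fgsetP c.
exists (\bigcup_(pq in G) (supp pq.1 `|` supp pq.2)); split.
  apply: bigcup_finite => // pq _; rewrite finite_setU.
  by split; [have [] := suppP pq.1 | have [] := suppP pq.2].
move=> h h' hh hh' hT ch; rewrite cG; apply: smallest_sub.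
  by apply: ker_congruence; case: hh'.
move=> [p q] Gpq /=; have [_ sp] := suppP p; have [_ sq] := suppP q.
rewrite -(sp h h')// => [|l pl]; last by apply: hT; exists (p, q) => //; left.
rewrite -(sq h h')// => [|l ql]; last by apply: hT; exists (p, q) => //; right.
by apply: (ch (p, q)); rewrite cG; apply: sub_gen_smallest.
Qed.

(** For complements [x], [y] the hypothesis makes [h] take its values in the
    distributive lattice [{\bot, x, y, \top}], of which [h1] and [h2] give
    the two coordinates. *)
Lemma ker_complement h h1 h2 x y :
  ends_hom o e h -> ends_hom o e h1 -> ends_hom o e h2 ->
  x `&` y = \bot -> x `|` y = \top ->
  (forall i, [/\ h1 (gen i) = \bot \/ h1 (gen i) = \top,
     h2 (gen i) = \bot \/ h2 (gen i) = \top
   & h (gen i) = (x `&` h1 (gen i)) `|` (y `&` h2 (gen i))]) ->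
  forall p q, h1 p = h1 q -> h2 p = h2 q -> h p = h q.
Proof.
move=> [[hI hU] h0 h1'] [[h1I h1U] h10 h11] [[h2I h2U] h20 h21] xy0 xy1 hgen.
suff hE p : [/\ h1 p = \bot \/ h1 p = \top, h2 p = \bot \/ h2 p = \top
   & h p = (x `&` h1 p) `|` (y `&` h2 p)].
  move=> p q e1 e2; have [_ _ ->] := hE p; have [_ _ ->] := hE q.
  by rewrite e1 e2.
move: p; apply: ends_hom_ind =>
  [||//|p q [a1 a2 ha] [b1 b2 hb]|p q [a1 a2 ha] [b1 b2 hb]].
- by rewrite h10 h20 h0 !meetx0 joinxx; split; auto.
- by rewrite h11 h21 h1' !meetx1 xy1; split; auto.
- rewrite hI h1I h2I ha hb; case: a1 => ->; case: a2 => ->; case: b1 => ->;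
  case: b2 => ->; rewrite ?(meetx0, meet0x, meetx1, meet1x, joinx0, join0x,
     joinx1, join1x, meetxx, joinxx, xy0, xy1, joinC y, meetC y); split; auto.
- rewrite hU h1U h2U ha hb; case: a1 => ->; case: a2 => ->; case: b1 => ->;
  case: b2 => ->; rewrite ?(meetx0, meet0x, meetx1, meet1x, joinx0, join0x,
     joinx1, join1x, meetxx, joinxx, xy0, xy1, joinC y, meetC y); split; auto.
Qed.

(** As [z <= x] fails, mapping the elements below [x] to [\bot] and those above
    [z] to [\top] is well defined, and is a homomorphism on the sublattice
    generated by the bounds and such elements. *)
Lemma ker_prime h h' x z :
  ends_hom o e h -> ends_hom o e h' -> ~~ (z <= x) ->
  (forall i, h' (gen i) = \bot /\ h (gen i) <= x \/
             h' (gen i) = \top /\ z <= h (gen i)) ->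
  forall p q, h p = h q -> h' p = h' q.
Proof.
move=> [[hI hU] h0 h1] [[hI' hU'] h0' h1'] zx hgen.
suff hE p : h' p = \bot /\ h p <= x \/ h' p = \top /\ z <= h p.
  move=> p q e1; case: (hE p) => -[-> hp]; case: (hE q) => -[-> hq] //;
    rewrite -e1 in hq; case/negP: zx.
    exact: le_trans hq hp.
  exact: le_trans hp hq.
move: p; apply: ends_hom_ind => [||//|p q hp hq|p q hp hq].
- by left; rewrite h0 le0x.
- by right; rewrite h1 lex1.
- rewrite hI' hI; case: hp => -[-> hp]; case: hq => -[-> hq];
    rewrite ?(meetx0, meet0x, meetxx); [left|left|left|right]; split=> //; lat.
- rewrite hU' hU; case: hp => -[-> hp]; case: hq => -[-> hq];
    rewrite ?(joinx1, join1x, joinxx);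
    [left|right|right|right]; split=> //; lat.
Qed.

End Homs.

(** One homomorphism, given by values [x], [y], [z] at a free triple [i], [j],
    [k], is compared with the three obtained by changing one of these values
    to [\bot]. The member of the refinement that belongs to the two other
    indices cannot tell the difference. *)
Lemma free_not_weak_uniform_refinement V X d (F : latticeType d)
    (gen : X -> F) (o e : F) (u v : X) :
  at_least_aleph 2 X -> nondistributive_variety V -> u <> v ->
  free_over_ends V gen o e u v ->
  ~ weak_uniform_refinement (congruence_semilattice F).
Proof.
move=> hX [dN [N [VN Ndis]]] uv [genF extF] wur.
have [o' [e' [x' [y' [z' [xyz' zx']]]]]] :=
  nondistributive_shared_complement Ndis.
have [dL [L [x [y [z [VL [[xy0 xy1 zy0 zy1] zxE]]]]]]] :=
  interval_in_variety VN xyz'.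
rewrite -zxE in zx' => {zxE xyz'}.
pose bot := o `&` e; pose top := o `|` e.
pose w i := (gen i `|` bot) `&` top.
have bot_w i : bot <= w i by rewrite /w /bot /top; lat.
have w_top i : w i <= top by rewrite /w; lat.
have hbot (h : F -> L) : ends_hom o e h -> h bot = \bot.
  by move=> [[hI _] h0 h1]; rewrite hI h0 meet0x.
have htop (h : F -> L) : ends_hom o e h -> h top = \top.
  by move=> [[_ hU] h0 h1]; rewrite hU h1 joinx1.
have hw (h : F -> L) i : ends_hom o e h -> h (w i) = h (gen i).
  move=> hh; have [[hI hU] _ _] := hh.
  by rewrite hI hU hbot// htop// joinx0 meetx1.
(* A homomorphism with given values on the generators needs the value [\top] at
   [v] and [\bot] at [u]. *)
pose val3 i j k a b c l : L := if `[< l = i >] then a else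
  if `[< l = j >] then b else if `[< l = k >] then c else
  if `[< l = v >] then \top else \bot.
(* Each pair occurs in both orders, according to a boolean: for the pairs
   [A i], [B i] in this order only there is a refinement, namely the congruences
   that force [w i <= w j]. *)
pose A i := principal_congruence bot (w i).
pose B i := principal_congruence (w i) top.
have AB i : A i `|` B i = principal_congruence bot top.
  exact: principal_congruence_split.
have [|c [ca cb cab ctri]] := wur (X * bool)%type
  (fun s => if s.2 then A s.1 else B s.1)
  (fun s => if s.2 then B s.1 else A s.1) (principal_congruence bot top).
  by move=> [i []] /=; rewrite // joinC.
pose ker (h : F -> L) := [set pq : F * F | h pq.1 = h pq.2].
have ker_cong h : ends_hom o e h -> is_congruence (ker h).
  by move=> [hh _ _]; apply: ker_congruence.
have [supp suppP] := boolp.choice (congruence_support (L := L) genF).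
pose T s t := supp (c s t).
have TP s t : finite_set (T s t) /\ forall h h', ends_hom o e h ->
    ends_hom o e h' -> (forall l, T s t l -> h (gen l) = h' (gen l)) ->
    fgset (c s t) `<=` ker h -> fgset (c s t) `<=` ker h'.
  exact: suppP.
(* The last set makes i, j, k distinct from each other and from u and v. *)
pose Phi i j := (T (i, false) (j, true) `|` T (i, true) (j, false))
  `|` (T (i, false) (j, false) `|` [set i; j; u; v]).
have [|i [j [k [kill_i kill_j kill_k]]]] := @free_triple X hX Phi.
  move=> i j; rewrite /Phi !finite_setU.
  have fT a b : finite_set (T a b) by have [] := TP a b.
  by do !split=> //; apply: finite_set1.
have neq a b l : ~ Phi a b l -> [/\ a <> l, b <> l, u <> l & v <> l].
  by move=> nPhi; split=> el; apply: nPhi; right; right; rewrite el /=; tauto.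
have [ji ki ui vi] := neq _ _ _ kill_i.
have [ij kj uj vj] := neq _ _ _ kill_j.
have [ik jk uk vk] := neq _ _ _ kill_k.
have ext a b c' : exists2 h : F -> L, ends_hom o e h &
    forall l, h (gen l) = val3 i j k a b c' l.
  apply: extF => //; rewrite /val3; first by rewrite !asboolF.
  by rewrite !(asboolF vi, asboolF vj, asboolF vk) asboolT.
have {ext} [h hP] : {h : L -> L -> L -> F -> L & forall a b c',
    ends_hom o e (h a b c') /\
    forall l, h a b c' (gen l) = val3 i j k a b c' l}.
  suff /boolp.choice[f fP] : forall abc : L * L * L, exists h : F -> L,
      ends_hom o e h /\
      forall l, h (gen l) = val3 i j k abc.1.1 abc.1.2 abc.2 l.
    by exists (fun a b c' => f (a, b, c')) => a b c'; apply: (fP (a, b, c')).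
  by move=> [[a b] c'] /=; have [h hh hg] := ext a b c'; exists h.
have hom a b c' : ends_hom o e (h a b c') by have [] := hP a b c'.
have hgen a b c' l : h a b c' (gen l) = val3 i j k a b c' l.
  by have [_] := hP a b c'.
have hi a b c' : h a b c' (w i) = a by rewrite hw// hgen /val3 asboolT.
have hj a b c' : h a b c' (w j) = b.
  by rewrite hw// hgen /val3 (asboolF (nesym ij)) asboolT.
have hk a b c' : h a b c' (w k) = c'.
  by rewrite hw// hgen /val3 (asboolF (nesym ik)) (asboolF (nesym jk)) asboolT.
have kerA a b c' l : h a b c' (w l) = \bot -> fgset (A l) `<=` ker (h a b c').
  move=> hl; apply: principal_congruence_sub; first exact: ker_cong.
  by rewrite /ker /= hbot.
have kerB a b c' l : h a b c' (w l) = \top -> fgset (B l) `<=` ker (h a b c').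
  move=> hl; apply: principal_congruence_sub; first exact: ker_cong.
  by rewrite /ker /= htop.
have caP s t : fgset (c s t) `<=` fgset (if s.2 then A s.1 else B s.1).
  exact/fg_leP/ca.
have cbP s t : fgset (c s t) `<=` fgset (if t.2 then B t.1 else A t.1).
  exact/fg_leP/cb.
(* This refinement is contained in both [B i] and [B j], hence it collapses
   nothing in the distributive lattice generated by complements [x] and [y]. *)
have kill_c : fgset (c (i, false) (j, true)) `<=` ker (h x y z).
  have [_ /(_ (h x y \bot))] := TP (i, false) (j, true); apply=> //.
    move=> l Tl; rewrite !hgen /val3.
    case: asboolP => // _; case: asboolP => // _.
    by case: asboolP => // lk; case: kill_k; left; left; rewrite -lk.
  move=> [p q] cpq; rewrite /ker /=; apply: (ker_complement genF (hom x y \bot)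
    (hom \top \bot \bot) (hom \bot \top \bot) xy0 xy1) => [l||].
  - rewrite !hgen /val3; do ?[case: asboolP => _];
      rewrite ?(meetx0, meetx1, joinx0, join0x, xy1); split; auto.
  - exact: (kerB _ _ _ i (hi _ _ _) _ (caP _ _ _ cpq)).
  - exact: (kerB _ _ _ j (hj _ _ _) _ (cbP _ _ _ cpq)).
(* Dually with [A j], [A k] and the complements [y] and [z]. *)
have kill_d : fgset (c (j, true) (k, false)) `<=` ker (h x y z).
  have [_ /(_ (h \bot y z))] := TP (j, true) (k, false); apply=> //.
    move=> l Tl; rewrite !hgen /val3; case: asboolP => [li|//].
    by case: kill_i; left; right; rewrite -li.
  have yz0 : y `&` z = \bot by rewrite meetC.
  have yz1 : y `|` z = \top by rewrite joinC.
  move=> [p q] cpq; rewrite /ker /=; apply: (ker_complement genF (hom \bot y z)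
    (hom \bot \top \bot) (hom \bot \bot \top) yz0 yz1) => [l||].
  - rewrite !hgen /val3; do ?[case: asboolP => _];
      rewrite ?(meetx0, meetx1, joinx0, join0x, yz1); split; auto.
  - exact: (kerA _ _ _ k (hk _ _ _) _ (cbP _ _ _ cpq)).
  - exact: (kerA _ _ _ j (hj _ _ _) _ (caP _ _ _ cpq)).
(* The triangle inequality is used at [x, y, z]; then [j], outside the support,
   is moved to [\bot], and [x], [z] are sent to the bounds. *)
have kill_e : fgset (c (i, false) (k, false)) `<=` ker (h \bot \bot \top).
  have : fgset (c (i, false) (k, false)) `<=` ker (h x \bot z).
    have [_ /(_ (h x y z))] := TP (i, false) (k, false); apply=> //.
      move=> l Tl; rewrite !hgen /val3; case: asboolP => // _.
      by case: asboolP => [lj|//]; case: kill_j; right; left; rewrite -lj.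
    have /fg_leP cij := ctri (i, false) (j, true) (k, false).
    by apply: (subset_trans cij); apply: fg_joinU_sub => //; apply: ker_cong.
  move=> cxz [p q] /cxz; apply: (ker_prime genF (hom x \bot z) (hom _ _ _) zx').
  move=> l; rewrite !hgen /val3; do ?[case: asboolP => _];
    rewrite ?(lexx, le0x, lex1); auto.
(* Here [A i] and [B k] are collapsed as well, so everything is. *)
have /fg_leP top_sub := cab (i, false) (k, false).
have topK : fgset (principal_congruence bot top) `<=` ker (h \bot \bot \top).
  have idK := ker_cong _ (hom \bot \bot \top); apply: (subset_trans top_sub).
  apply: fg_joinU_sub => //; last by apply: kerA; rewrite /= hi.
  by apply: fg_joinU_sub => //; apply: kerB; rewrite /= hk.
have := topK _ (principal_congruence_mem bot top).
rewrite /ker /= hbot// htop// => bt; case/negP: zx'.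
by apply: le_trans (lex1 z) _; rewrite -bt le0x.
Qed.

(** * Free lattices and regular rings *)

Lemma at_least_aleph2_two_points X : at_least_aleph 2 X ->
  exists u v : X, u <> v.
Proof.
move=> hX; have [|i [j [k [ijk _ _]]]] :=
  @free_triple X hX (fun i j => [set i; j]).
  by move=> i j; rewrite finite_setU; split; apply: finite_set1.
by exists i, j => ij; apply: ijk; left.
Qed.

Theorem corollary4p3 (V : lattice_variety) (hV : nondistributive_variety V)
    (X : Type) (hX : at_least_aleph 2 X) :
  (forall (d : Order.disp_t) (F : latticeType d) (i : X -> F),
     free_lattice V i ->
     ~ exists R : rngType, von_neumann_regular R /\
         bsemilattice_iso (ideal_semilattice R) (congruence_semilattice F)) /\
  (forall (d : Order.disp_t) (F : tbLatticeType d) (i : X -> F),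
     free_bounded_lattice V i ->
     ~ exists R : rngType, von_neumann_regular R /\
         bsemilattice_iso (ideal_semilattice R) (congruence_semilattice F)).
Proof.
have [u [v uv]] := at_least_aleph2_two_points hX.
split=> d F gen freeF [R [regR iso]];
  have wur := weak_uniform_refinement_iso iso
    (regular_weak_uniform_refinement regR).
- exact: (free_not_weak_uniform_refinement hX hV uv
    (free_lattice_over_ends u v freeF) wur).
- exact: (free_not_weak_uniform_refinement hX hV uv
    (free_bounded_lattice_over_ends u v freeF) wur).
Qed.
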